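(* Let $A$ be a $4$-dimensional non-split non-Lie nilpotent Leibniz algebra over $\mathbb{C}$ with $\dim(A^2)=2=\dim(\mathrm{Leib}(A))$ and $\dim(A^3)=1$. Then $A$ is isomorphic to a Leibniz algebra spanned by $\{x_1,x_2,x_3,x_4\}$ (a basis) with the nonzero products given by one of the following: $\mathcal{A}_{20}$: $[x_1,x_2]=x_3,\ [x_1,x_3]=x_4$. $\mathcal{A}_{21}$: $[x_1,x_2]=x_3,\ [x_2,x_2]=x_4,\ [x_1,x_3]=x_4$. $\mathcal{A}_{22}$: $[x_1,x_2]=x_3,\ [x_2,x_1]=x_4,\ [x_1,x_3]=x_4$. $\mathcal{A}_{23}$: $[x_1,x_2]=x_3,\ [x_2,x_1]=x_4,\ [x_2,x_2]=x_4,\ [x_1,x_3]=x_4$. $\mathcal{A}_{24}$: $[x_1,x_1]=x_3,\ [x_2,x_1]=x_4,\ [x_1,x_3]=x_4$. $\mathcal{A}_{25}$: $[x_1,x_1]=x_3,\ [x_2,x_2]=x_4,\ [x_1,x_3]=x_4$.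
   Context: All algebras are over $\mathbb{C}$. A (left) Leibniz algebra is a $\mathbb{C}$-vector space $A$ with a bilinear product $[\,,\,]:A\times A\to A$ such that every left multiplication operator is a derivation, i.e. $[a,[b,c]]=[[a,b],c]+[b,[a,c]]$ for all $a,b,c\in A$. Put $A^1=A$ and $A^i=[A,A^{i-1}]$ (the span of the products) for $i\ge 2$; $A$ is nilpotent if $A^{c+1}=0$ for some positive integer $c$. $\mathrm{Leib}(A)=\mathrm{span}\{[a,a]\mid a\in A\}$; $A$ is a Lie algebra if and only if $\mathrm{Leib}(A)=0$, and ''non-Lie'' means $\mathrm{Leib}(A)\ne 0$. $A$ is split if it is a direct sum of two nontrivial ideals, and non-split otherwise. Products of basis elements not listed are zero. *)

(* Defs.v *)
From HB Require Import structures.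
From mathcomp Require Import all_boot all_order all_algebra sesquilinear.
From mathcomp Require Import boolp classical_sets reals.
From mathcomp.real_closed Require Import complex.
From mathcomp Require Import ring.

Set Implicit Arguments.
Unset Strict Implicit.
Unset Printing Implicit Defensive.

Import GRing.Theory.
Local Open Scope ring_scope.

Section Span.
Variables (K : fieldType) (V : vectType K).

Definition is_span (S : V -> Prop) (U : {vspace V}) : Prop :=
  forall v, v \in U <->
    exists s : seq V, (forall x, x \in s -> S x) /\ v \in <<s>>%VS.

(* The default value 0 is never used: a span always exists, see [spanvP]. *)
Definition spanv (S : V -> Prop) : {vspace V} := xget 0%VS (is_span S).

Lemma spanvP (S : V -> Prop) : is_span S (spanv S).
Proof.
apply: xgetPex.
pose P d := `[< exists s : seq V, (forall x, x \in s -> S x)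
                                  /\ \dim <<s>>%VS = d >].
have exP : exists d, P d by exists (\dim <<[::] : seq V>>%VS); apply/asboolP; exists [::].
have ubP d : P d -> (d <= \dim {:V})%N.
  by move=> /asboolP[s [_ <-]]; rewrite dimvS ?subvf.
case: (ex_maxnP exP ubP) => d /asboolP[s [sS dim_s]] maxd.
exists <<s>>%VS => v; split=> [vs|[t [tS vt]]]; first by exists s.
have st : (<<s>> <= <<s ++ t>>)%VS by rewrite span_cat addvSl.
have /eqP-> : <<s>>%VS == <<s ++ t>>%VS.
  rewrite eqEdim st dim_s maxd //; apply/asboolP; exists (s ++ t); split=> // x.
  by rewrite mem_cat => /orP[/sS|/tS].
by rewrite span_cat; apply: subvP vt; rewrite addvSr.
Qed.

End Span.

Definition leibniz_law (V : zmodType) (br : V -> V -> V) : Prop :=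
  forall a b c, br a (br b c) = br (br a b) c + br b (br a c).

Record leibnizAlgebra (K : fieldType) := LeibnizAlgebra {
  leib_sort :> vectType K;
  bracket : {bilinear leib_sort -> leib_sort -> leib_sort};
  bracket_leibniz : leibniz_law bracket
}.

Section LeibnizTheory.
Variables (K : fieldType) (A : leibnizAlgebra K).

Definition bracketv (U W : {vspace A}) : {vspace A} :=
  spanv (fun v : A => exists2 u, u \in U & exists2 w, w \in W & v = bracket A u w).

(* [leib_pow i] is A^i for i >= 1; A^0 is A by convention. *)
Definition leib_pow (i : nat) : {vspace A} := iter i.-1 (bracketv fullv) fullv.

Definition nilpotent_leib : Prop := exists2 c, (0 < c)%N & leib_pow c.+1 = 0%VS.

Definition Leib : {vspace A} := spanv (fun v : A => exists a, v = bracket A a a).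

Definition non_Lie : Prop := Leib <> 0%VS.

Definition is_ideal (I : {vspace A}) : Prop :=
  forall a u : A, u \in I -> bracket A a u \in I /\ bracket A u a \in I.

Definition split_leib : Prop :=
  exists I J : {vspace A},
    [/\ is_ideal I, is_ideal J, I <> 0%VS & J <> 0%VS] /\
    (I + J = fullv)%VS /\ (I :&: J = 0)%VS.

End LeibnizTheory.

Definition isomorphic_leib (K : fieldType) (A B : leibnizAlgebra K) : Prop :=
  exists f : {linear A -> B},
    bijective f /\ {morph f : a b / bracket A a b >-> bracket B a b}.

Section Tables.
Variable K : fieldType.

(* Basis x_1, ..., x_4 of K^4, numbered from 1. *)
Definition xb (k : nat) : 'rV[K]_4 := delta_mx 0 (inord k.-1).

Definition xcoord (v : 'rV[K]_4) (k : nat) : K := v 0 (inord k.-1).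

(* An entry (i, j, k) of the table [t] stands for [x_i, x_j] = x_k; products of
   basis vectors that are not listed are zero, see [table_bracketE]. *)
Definition table_bracket (t : seq (nat * nat * nat)) (u v : 'rV[K]_4) : 'rV[K]_4 :=
  \sum_(p <- t) (xcoord u p.1.1 * xcoord v p.1.2) *: xb p.2.

Lemma table_bilinear t :
  bilinear_for ( *:%R : K -> 'rV[K]_4 -> 'rV[K]_4) *:%R (table_bracket t).
Proof.
split=> w a u v /=; rewrite /table_bracket scaler_sumr -big_split /=;
  apply: eq_bigr => p _; rewrite scalerA -scalerDl /xcoord !mxE;
  by congr (_ *: _); ring.
Qed.

HB.instance Definition _ t :=
  bilinear_isBilinear.Build K _ _ _ _ _ (table_bracket t) (table_bilinear t).

Definition table_algebra t (tL : leibniz_law (table_bracket t)) :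
  leibnizAlgebra K := @LeibnizAlgebra K 'rV[K]_4 (table_bracket t) tL.

Lemma xcoord_xb i j : (0 < i <= 4)%N -> (0 < j <= 4)%N ->
  xcoord (xb i) j = (i == j)%:R.
Proof.
case: i j => [|i] [|j] //= hi hj.
by rewrite /xcoord /xb mxE eqxx -val_eqE /= !inordK // eq_sym.
Qed.

Lemma table_bracketE t i j :
  all (fun p => (0 < p.1.1 <= 4) && (0 < p.1.2 <= 4))%N t ->
  (0 < i <= 4)%N -> (0 < j <= 4)%N ->
  table_bracket t (xb i) (xb j) =
  \sum_(p <- t | (p.1.1 == i) && (p.1.2 == j)) xb p.2.
Proof.
move=> /allP tP hi hj; rewrite /table_bracket [RHS]big_mkcond /=.
apply: eq_big_seq => p /tP /andP[h1 h2].
rewrite !xcoord_xb // -natrM mulnb [i == _]eq_sym [j == _]eq_sym.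
by case: (_ && _); rewrite ?scale1r ?scale0r.
Qed.

Definition table20 := [:: (1, 2, 3); (1, 3, 4)]%N.
Definition table21 := [:: (1, 2, 3); (2, 2, 4); (1, 3, 4)]%N.
Definition table22 := [:: (1, 2, 3); (2, 1, 4); (1, 3, 4)]%N.
Definition table23 := [:: (1, 2, 3); (2, 1, 4); (2, 2, 4); (1, 3, 4)]%N.
Definition table24 := [:: (1, 1, 3); (2, 1, 4); (1, 3, 4)]%N.
Definition table25 := [:: (1, 1, 3); (2, 2, 4); (1, 3, 4)]%N.

Ltac table_leibniz :=
  move=> a b c; rewrite /table_bracket !big_cons !big_nil /xcoord /xb /=;
  apply/rowP => k; rewrite !mxE -!val_eqE /= !inordK //=; ring.

Lemma leibniz20 : leibniz_law (table_bracket table20).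
Proof. table_leibniz. Qed.
Lemma leibniz21 : leibniz_law (table_bracket table21).
Proof. table_leibniz. Qed.
Lemma leibniz22 : leibniz_law (table_bracket table22).
Proof. table_leibniz. Qed.
Lemma leibniz23 : leibniz_law (table_bracket table23).
Proof. table_leibniz. Qed.
Lemma leibniz24 : leibniz_law (table_bracket table24).
Proof. table_leibniz. Qed.
Lemma leibniz25 : leibniz_law (table_bracket table25).
Proof. table_leibniz. Qed.

Definition A20 : leibnizAlgebra K := table_algebra leibniz20.
Definition A21 : leibnizAlgebra K := table_algebra leibniz21.
Definition A22 : leibnizAlgebra K := table_algebra leibniz22.
Definition A23 : leibnizAlgebra K := table_algebra leibniz23.
Definition A24 : leibnizAlgebra K := table_algebra leibniz24.
Definition A25 : leibnizAlgebra K := table_algebra leibniz25.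

End Tables.

Arguments A20 : clear implicits.
Arguments A21 : clear implicits.
Arguments A22 : clear implicits.
Arguments A23 : clear implicits.
Arguments A24 : clear implicits.
Arguments A25 : clear implicits.

(* Main.v *)
Require Import Defs.
From HB Require Import structures.
From mathcomp Require Import all_boot all_order all_algebra reals.
From mathcomp Require Import sesquilinear boolp ring.
From mathcomp.real_closed Require Import complex.

Set Implicit Arguments.
Unset Strict Implicit.
Unset Printing Implicit Defensive.

Import GRing.Theory.
Local Open Scope ring_scope.

(** The Leibniz identity with a = b gives [[a, a], c] = 0, so Leib(A) annihilates
    A from the left. Since Leib(A) is contained in A^2 and both are planes, they
    coincide, hence [A^2, A] = 0; nilpotency and dim A^3 = 1 force A^4 = 0.

    Choose z in A^2 and x with w := [x, z] nonzero. Then A^3 = <w>,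
    A^2 = <z, w> and x is not in A^2. The map a |-> [a, z] has values in <w>, so a
    fourth basis vector can be corrected by a multiple of x into some y with
    [y, z] = 0. Applying the Leibniz identity to [y, [x, a]], with [y, x] in A^2,
    shows that [y, a] lies in <w> for every a. Thus [y, x] = b w, [y, y] = c w,
    and only the products
      [x, x] = m z + be w   and   [x, y] = n z + ga w
    involve z; m and n are not both 0, because A^2 is not contained in <w>.
    Such a basis is a [frame], and [exists_frame] produces one.

    What remains is the action of the changes of frame, recorded by
    [frame_change]: for x' = s x + u y + k z, y' = t y + l z, z' = p z + q w and
    w' = s p w the constants become
      b' = t (s b + u c) / (s p)   and   c' = t^2 c / (s p).
    - If n <> 0, one may take [x, x] = 0 and z = [x, y]. Rescaling x by s and y by t
      then divides b by s and multiplies c by t / s^2, so b and c can be made 0 or 1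
      independently: these are the algebras A20, A21, A22, A23.
    - If n = 0, one may take [x, x] = z and [x, y] = 0. If b = c = 0 the line of y
      is a direct factor, which is excluded. If c = 0 and b <> 0, rescaling y gives
      A24; if c <> 0, replacing x by c x - b y kills b, and the scaling that
      makes c equal to 1 is rational in c, giving A25.
    No roots are extracted, so the argument works over an arbitrary field K. *)

(** * Brackets, the lower central series and Leib *)

Section Bracket.
Context {K : fieldType} {A : leibnizAlgebra K}.
Local Notation "'[ a , b ]" := (bracket A a b) (at level 0).
Implicit Types (a b u v : A) (U W S : {vspace A}).

Lemma brDl a b u : '[a + b, u] = '[a, u] + '[b, u].
Proof. exact: linearDl. Qed.
Lemma brDr a b u : '[u, a + b] = '[u, a] + '[u, b].
Proof. exact: linearDr. Qed.
Lemma brZl k a u : '[k *: a, u] = k *: '[a, u].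
Proof. exact: linearZl_LR. Qed.
Lemma brZr k a u : '[u, k *: a] = k *: '[u, a].
Proof. exact: linearZr_LR. Qed.
Lemma br0l u : '[0, u] = 0. Proof. exact: linear0l. Qed.
Lemma br0r u : '[u, 0] = 0. Proof. exact: linear0r. Qed.

Lemma br_suml I r (P : pred I) (F : I -> A) u :
  '[\sum_(i <- r | P i) F i, u] = \sum_(i <- r | P i) '[F i, u].
Proof.
exact: (big_morph (fun v => '[v, u]) (fun a b => brDl a b u) (br0l u)).
Qed.

Lemma br_sumr I r (P : pred I) (F : I -> A) u :
  '[u, \sum_(i <- r | P i) F i] = \sum_(i <- r | P i) '[u, F i].
Proof.
exact: (big_morph (fun v => '[u, v]) (fun a b => brDr a b u) (br0r u)).
Qed.

Lemma spanv_sub (P : A -> Prop) S : (forall v, P v -> v \in S) -> (spanv P <= S)%VS.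
Proof.
move=> PS; apply/subvP => v /spanvP[s [sP]].
by apply/subvP/span_subvP => x /sP/PS.
Qed.

Lemma mem_spanv (P : A -> Prop) v : P v -> v \in spanv P.
Proof.
move=> Pv; apply/spanvP; exists [:: v]; split=> [x|]; last by rewrite memv_span1.
by rewrite inE => /eqP->.
Qed.

Lemma bracketv_sub U W S :
  (forall u w, u \in U -> w \in W -> '[u, w] \in S) -> (bracketv U W <= S)%VS.
Proof. by move=> H; apply: spanv_sub => v [u uU [w wW ->]]; apply: H. Qed.

Lemma mem_bracketv U W u w : u \in U -> w \in W -> '[u, w] \in bracketv U W.
Proof. by move=> uU wW; apply: mem_spanv; exists u => //; exists w. Qed.

Lemma mem_leib_powS i a u : (0 < i)%N ->
  u \in leib_pow A i -> '[a, u] \in leib_pow A i.+1.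
Proof. by case: i => // i _ ui; apply: mem_bracketv; rewrite ?memvf. Qed.

Lemma leib_powS_sub i : (0 < i)%N -> (leib_pow A i.+1 <= leib_pow A i)%VS.
Proof.
case: i => // i _; elim: i => [|i IHi]; first exact: subvf.
apply: bracketv_sub => u w _ wi; apply: mem_leib_powS => //.
exact: (subvP IHi).
Qed.

(** If two consecutive terms of the series agree, it is constant from there on,
    and nilpotency makes that constant 0. *)
Lemma nilpotent_leib_pow_neq i : (0 < i)%N -> nilpotent_leib A ->
  leib_pow A i <> 0%VS -> leib_pow A i.+1 <> leib_pow A i.
Proof.
case: i => // i _ [c c0 powc] ni0 stat; apply: ni0.
have const k : leib_pow A (i.+1 + k) = leib_pow A i.+1.
  elim: k => [|k IHk]; first by rewrite addn0.
  by rewrite addnS -[RHS]stat /leib_pow /= -[iter _ _ _]/(leib_pow A (i.+1 + k)) IHk.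
rewrite -(const c.+1).
have below k : leib_pow A (c.+1 + k) = 0%VS.
  elim: k => [|k IHk]; first by rewrite addn0.
  by apply/eqP; rewrite -subv0 addnS -IHk leib_powS_sub.
by rewrite addnC below.
Qed.

(** Both [a, [a, b]] terms of the Leibniz identity cancel. *)
Lemma br_square_l a b : '[ '[a, a], b] = 0.
Proof.
by have /eqP := bracket_leibniz a a b; rewrite -subr_eq subrr => /eqP.
Qed.

Lemma br_Leib_l u b : u \in Leib A -> '[u, b] = 0.
Proof.
move=> /spanvP[s [sP us]].
rewrite (coord_span (X := in_tuple s) us) br_suml big1 // => i _.
have [|a /= ->] := sP s`_i; first exact: mem_nth.
by rewrite brZl br_square_l scaler0.
Qed.

Lemma Leib_sub_square : (Leib A <= leib_pow A 2)%VS.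
Proof. by apply: spanv_sub => _ [a ->]; apply: mem_leib_powS; rewrite ?memvf. Qed.

End Bracket.

(** * Recognising an algebra by its multiplication table *)

Section Table.
Context {K : fieldType} {A : leibnizAlgebra K}.

(** The isomorphism takes coordinates in the basis X. Multiplicativity is checked
    on its inverse g, where both sides are explicit combinations of X. *)
Lemma isomorphic_table (t : seq (nat * nat * nat))
    (tL : leibniz_law (table_bracket (K := K) t)) (X : 4.-tuple A) :
  basis_of fullv X ->
  all (fun p => [&& 0 < p.1.1 <= 4, 0 < p.1.2 <= 4 & 0 < p.2 <= 4])%N t ->
  (forall i j : 'I_4, bracket A X`_i X`_j =
     \sum_(p <- t | (p.1.1 == i.+1) && (p.1.2 == j.+1)) X`_p.2.-1) ->
  isomorphic_leib A (table_algebra tL).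
Proof.
move=> bX /allP t4 HX.
have freeX := basis_free bX.
pose f (a : A) : table_algebra tL := \row_i coord X i a.
pose g (v : table_algebra tL) : A := \sum_(i < 4) v 0 i *: X`_i.
have f_lin : linear f.
  by move=> k a b; apply/rowP => i; rewrite !mxE linearP.
have fK : cancel f g.
  move=> a; rewrite [RHS](coord_basis bX (memvf a)).
  by apply: eq_bigr => i _; rewrite mxE.
have gK : cancel g f by move=> v; apply/rowP => i; rewrite mxE coord_sum_free.
have g_lin : linear g.
  by move=> k a b; apply: (can_inj fK); rewrite f_lin !gK.
pose gl : {linear table_algebra tL -> A} :=
  HB.pack g (GRing.isLinear.Build _ _ _ _ _ g_lin).
pose fl : {linear A -> table_algebra tL} :=
  HB.pack f (GRing.isLinear.Build _ _ _ _ _ f_lin).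
have g_xb k : (0 < k <= 4)%N -> g (xb K k) = X`_k.-1.
  case: k => // k /= k4; rewrite /g (bigD1 (inord k)) //= big1 => [|i ik].
    by rewrite /xb mxE !eqxx inordK // scale1r addr0.
  by rewrite /xb mxE (negPf ik) andbF scale0r.
have g_br u v : g (table_bracket t u v) = bracket A (g u) (g v).
  rewrite [LHS](linear_sum gl) [in RHS]/g br_suml.
  under [RHS]eq_bigr => i _ do [
    rewrite br_sumr; under eq_bigr => j _ do
      rewrite brZl brZr scalerA HX big_mkcond scaler_sumr;
    rewrite exchange_big].
  (* Of the coordinate pairs (i, j), an entry of t selects exactly one. *)
  rewrite [RHS]exchange_big; apply: eq_big_seq => -[[p1 p2] p3] /t4 /= /and3P[].
  case: p1 p2 => [|p1] [|p2] //= p14 p24 p34.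
  rewrite [LHS](linearZ_LR gl) [gl _]g_xb //.
  rewrite (bigD1 (inord p1)) //= (bigD1 (inord p2)) //=.
  rewrite !inordK // !eqxx /xcoord /=.
  rewrite big1 => [|j jp]; last first.
    rewrite eq_sym -(inj_eq val_inj) /= inordK // in jp.
    by rewrite !eqSS (negPf jp) scaler0.
  rewrite big1 => [|i ip]; first by rewrite !addr0.
  rewrite big1 // => j _.
  rewrite eq_sym -(inj_eq val_inj) /= inordK // in ip.
  by rewrite !eqSS (negPf ip) scaler0.
exists fl; split=> [|a b]; first by exists g.
by apply: (can_inj gK); rewrite /= fK [RHS]g_br !fK.
Qed.
End Table.

(** * Frames and their changes *)

Section Frames.
Context {K : fieldType} {A : leibnizAlgebra K}.
Local Notation "'[ a , b ]" := (bracket A a b) (at level 0).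

(** A basis adapted to A > A^2 = <z, w> > A^3 = <w>, with y chosen in the kernel of
    the left action on A^2 / A^3. Nothing is imposed on [x, x] and [x, y], because
    the two normal forms of these products are the branches of the
    classification. *)
Record frame (x y z w : A) (b c : K) : Prop := Frame {
  frame_basis : basis_of fullv [:: x; y; z; w];
  frame_xz : '[x, z] = w;
  frame_yx : '[y, x] = b *: w;
  frame_yy : '[y, y] = c *: w;
  frame_yz : '[y, z] = 0;
  frame_zl a : '[z, a] = 0;
  frame_wl a : '[w, a] = 0;
  frame_wr a : '[a, w] = 0 }.

Lemma basis4_coord (x y z w a : A) : basis_of fullv [:: x; y; z; w] ->
  exists s u k l, a = s *: x + u *: y + k *: z + l *: w.
Proof.
move=> bX; have := coord_basis (X := [tuple x; y; z; w]) bX (memvf a).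
rewrite !big_ord_recl big_ord0 /= addr0 !addrA => ->.
by do 4 eexists.
Qed.

(** The change is triangular with invertible diagonal, so w, z, y, x are recovered
    in this order. *)
Lemma basis4_change (x y z w : A) (s u k t l p q r : K) :
  s != 0 -> t != 0 -> p != 0 -> r != 0 ->
  basis_of fullv [:: x; y; z; w] ->
  basis_of fullv [:: s *: x + u *: y + k *: z; t *: y + l *: z;
                     p *: z + q *: w; r *: w].
Proof.
move=> s0 t0 p0 r0 bX.
rewrite basisEdim (size_basis (X := [tuple x; y; z; w]) bX) leqnn andbT.
set S := span _.
have inS v : v \in [:: s *: x + u *: y + k *: z; t *: y + l *: z;
                       p *: z + q *: w; r *: w] -> v \in S by exact: memv_span.
have scaleS m v : m != 0 -> m *: v \in S -> v \in S.
  by move=> m0 mvS; rewrite -[v]scale1r -(mulVf m0) -scalerA memvZ.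
have wS : w \in S by apply: (scaleS r) => //; apply: inS; rewrite !inE eqxx !orbT.
have zS : z \in S.
  apply: (scaleS p) => //; rewrite -(addrK (q *: w) (p *: z)).
  by rewrite rpredB ?memvZ // inS // !inE eqxx !orbT.
have yS : y \in S.
  apply: (scaleS t) => //; rewrite -(addrK (l *: z) (t *: y)).
  by rewrite rpredB ?memvZ // inS // !inE eqxx !orbT.
have xS : x \in S.
  apply: (scaleS s) => //; rewrite -(addrK (u *: y + k *: z) (s *: x)).
  by apply: rpredB; [rewrite addrA inS ?inE ?eqxx | rewrite rpredD ?memvZ].
apply/subvP => a _; have [c1 [c2 [c3 [c4 ->]]]] := basis4_coord a bX.
by rewrite !rpredD ?memvZ.
Qed.

Section OneFrame.
Context (x y z w : A) (b c : K) (F : frame x y z w b c).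

(** The case of elements without w component suffices: w is in the two-sided
    annihilator. *)
Lemma frame_bracket s u k s' u' k' :
  '[s *: x + u *: y + k *: z, s' *: x + u' *: y + k' *: z] =
  (s * s') *: '[x, x] + (s * u') *: '[x, y]
    + (u * s' * b + u * u' * c + s * k') *: w.
Proof.
rewrite !(brDl, brDr, brZl, brZr) (frame_xz F) (frame_yx F) (frame_yy F).
rewrite (frame_yz F) !(frame_zl F) !scalerDr !scaler0 !addr0 !scalerA -!addrA.
congr (_ + (_ + _)); rewrite -!scalerDl; congr (_ *: _); ring.
Qed.

Lemma frame_bracket_xx s u k :
  '[s *: x + u *: y + k *: z, s *: x + u *: y + k *: z] =
  (s ^+ 2) *: '[x, x] + (s * u) *: '[x, y]
    + (s * u * b + u ^+ 2 * c + s * k) *: w.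
Proof. by rewrite frame_bracket [u * s]mulrC. Qed.

Lemma frame_bracket_xy s u k t l :
  '[s *: x + u *: y + k *: z, t *: y + l *: z] =
  (s * t) *: '[x, y] + (u * t * c + s * l) *: w.
Proof.
have := frame_bracket s u k 0 t l.
by rewrite scale0r add0r !mulr0 mul0r scale0r !add0r.
Qed.

(** The scaling of w is forced by [x', z'] = w'. *)
Lemma frame_change s u k t l p q : s != 0 -> t != 0 -> p != 0 ->
  frame (s *: x + u *: y + k *: z) (t *: y + l *: z) (p *: z + q *: w)
        ((s * p) *: w) (t * (s * b + u * c) / (s * p)) (t ^+ 2 * c / (s * p)).
Proof.
move=> s0 t0 p0; have sp0 : s * p != 0 by rewrite mulf_neq0.
have scal m : (m / (s * p)) *: ((s * p) *: w) = m *: w by rewrite scalerA divfK.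
have xx := frame_bracket 0 t l s u k; have yy := frame_bracket 0 t l 0 t l.
rewrite scale0r add0r !mul0r !scale0r !add0r addr0 in xx.
rewrite scale0r add0r !mul0r !mulr0 !scale0r !add0r mul0r add0r addr0 in yy.
split; rewrite ?scal.
- exact: basis4_change (frame_basis F).
- rewrite !(brDl, brDr, brZl, brZr) (frame_xz F) (frame_yz F) !(frame_zl F).
  by rewrite !(frame_wr F) !scalerDr !scaler0 !addr0 !scalerA.
- by rewrite xx; congr (_ *: _); ring.
- by rewrite yy.
- rewrite !(brDl, brDr, brZl, brZr) (frame_yz F) !(frame_zl F) !(frame_wr F).
  by rewrite !scalerDr !scaler0 !addr0.
- by move=> a; rewrite brDl !brZl (frame_zl F) (frame_wl F) !scaler0 addr0.
- by move=> a; rewrite brZl (frame_wl F) scaler0.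
- by move=> a; rewrite brZr (frame_wr F) scaler0.
Qed.

(** The ideals are <y>, which here is in the two-sided annihilator, and
    <x, z, w>, which contains all products. *)
Lemma frame_split : '[x, x] = z -> '[x, y] = 0 -> b = 0 -> c = 0 -> split_leib A.
Proof.
move=> xx xy b0 c0; have bF := frame_basis F.
have br_y0 a : '[a, y] = 0 /\ '[y, a] = 0.
  have [s [u [k [l ->]]]] := basis4_coord a bF.
  rewrite !(brDl, brDr, brZl, brZr) xy (frame_yx F) (frame_yy F) (frame_yz F).
  by rewrite (frame_zl F) (frame_wl F) (frame_wr F) b0 c0 !scale0r !scaler0 !addr0.
have br_xzw a a' : '[a, a'] \in <<[:: x; z; w]>>%VS.
  have [s [u [k [l ->]]]] := basis4_coord a bF.
  have [s' [u' [k' [l' ->]]]] := basis4_coord a' bF.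
  rewrite brDr brDl !brZl !brZr (frame_wl F) (frame_wr F) !scaler0 !addr0.
  rewrite frame_bracket xx xy scaler0 addr0.
  by rewrite rpredD ?memvZ // memv_span // !inE eqxx !orbT.
have /basis_free : basis_of fullv ([:: y] ++ [:: x; z; w]).
  by rewrite -(perm_basis (X := [:: x; y; z; w])) // (perm_catCA [:: x] [:: y]).
rewrite cat_free => /and3P[fy fxzw /directv_addP dir].
exists <[y]>%VS, <<[:: x; z; w]>>%VS; split; split=> //.
- move=> a v /vlineP[k ->]; have [ay ya] := br_y0 a.
  by rewrite brZl brZr ay ya scaler0 mem0v.
- by move/eqP; rewrite -dimv_eq0 dim_vline; rewrite seq1_free in fy; rewrite fy.
- by move/eqP; rewrite -dimv_eq0; move: fxzw; rewrite /free => /eqP->.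
- apply/eqP; rewrite eqEsubv subvf; apply/subvP => a _.
  have [s [u [k [l ->]]]] := basis4_coord a bF.
  rewrite [s *: x + _]addrC -!addrA memv_add ?memvZ ?memv_line //.
  by rewrite !rpredD ?memvZ // memv_span // !inE eqxx ?orbT.
- by rewrite -dir span_seq1.
Qed.

End OneFrame.

(* Compares the sixteen products of frame vectors with the entries of the table. *)
Ltac table_products F xx xy :=
  apply: (@isomorphic_table _ _ _ _ [tuple _; _; _; _] (frame_basis F)) => //;
  case=> [[|[|[|[|//]]]] ?] [[|[|[|[|//]]]] ?];
  rewrite ?xx ?xy /= !big_cons big_nil /= ?(frame_xz F) ?(frame_yx F)
   ?(frame_yy F) ?(frame_yz F) ?(frame_zl F)
   ?(frame_wl F) ?(frame_wr F) ?xx ?xy ?addr0 ?scale0r ?scale1r.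

Lemma frame_A20 x y z w : frame x y z w 0 0 -> '[x, x] = 0 -> '[x, y] = z ->
  isomorphic_leib A (A20 K).
Proof. by move=> F xx xy; table_products F xx xy. Qed.
Lemma frame_A21 x y z w : frame x y z w 0 1 -> '[x, x] = 0 -> '[x, y] = z ->
  isomorphic_leib A (A21 K).
Proof. by move=> F xx xy; table_products F xx xy. Qed.
Lemma frame_A22 x y z w : frame x y z w 1 0 -> '[x, x] = 0 -> '[x, y] = z ->
  isomorphic_leib A (A22 K).
Proof. by move=> F xx xy; table_products F xx xy. Qed.
Lemma frame_A23 x y z w : frame x y z w 1 1 -> '[x, x] = 0 -> '[x, y] = z ->
  isomorphic_leib A (A23 K).
Proof. by move=> F xx xy; table_products F xx xy. Qed.
Lemma frame_A24 x y z w : frame x y z w 1 0 -> '[x, x] = z -> '[x, y] = 0 ->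
  isomorphic_leib A (A24 K).
Proof. by move=> F xx xy; table_products F xx xy. Qed.
Lemma frame_A25 x y z w : frame x y z w 0 1 -> '[x, x] = z -> '[x, y] = 0 ->
  isomorphic_leib A (A25 K).
Proof. by move=> F xx xy; table_products F xx xy. Qed.

End Frames.

(** * Normal forms *)

Section Classification.
Context {K : fieldType} {A : leibnizAlgebra K}.
Local Notation "'[ a , b ]" := (bracket A a b) (at level 0).

Lemma frame_rescale (x y z w : A) b c s u k t l p q b' c' :
  frame x y z w b c -> s != 0 -> t != 0 -> p != 0 ->
  t * (s * b + u * c) = b' * (s * p) -> t ^+ 2 * c = c' * (s * p) ->
  frame (s *: x + u *: y + k *: z) (t *: y + l *: z) (p *: z + q *: w)
        ((s * p) *: w) b' c'.
Proof.
move=> F s0 t0 p0 eb ec; have := frame_change F u k l q s0 t0 p0.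
by rewrite eb ec !mulfK ?mulf_neq0.
Qed.

(** Rescaling x by s and y by t divides b by s and multiplies c by t / s^2. *)
Lemma classify_xy (x y z w : A) b c :
  frame x y z w b c -> '[x, x] = 0 -> '[x, y] = z ->
  isomorphic_leib A (A20 K) \/ isomorphic_leib A (A21 K) \/
  isomorphic_leib A (A22 K) \/ isomorphic_leib A (A23 K).
Proof.
move=> F xx xy.
have scaled s t b' c' : s != 0 -> t != 0 -> b = b' * s -> t * c = c' * s ^+ 2 ->
  exists x' y' z' w', [/\ frame x' y' z' w' b' c', '[x', x'] = 0 & '[x', y'] = z'].
  move=> s0 t0 eb ec; set p := s * t.
  exists (s *: x + 0 *: y + 0 *: z), (t *: y + 0 *: z), (p *: z + 0 *: w).
  exists ((s * p) *: w).
  split.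
  - apply: frame_rescale F s0 t0 (mulf_neq0 s0 t0) _ _.
      by rewrite eb mul0r addr0 /p; ring.
    by rewrite expr2 -mulrA ec /p; ring.
  - rewrite (frame_bracket_xx F) xx scaler0 !mulr0 !mul0r expr0n /= mul0r !scale0r.
    by rewrite !addr0 add0r scale0r.
  - by rewrite (frame_bracket_xy F) xy !mul0r mulr0 addr0.
have [b0|b0] := eqVneq b 0; have [c0|c0] := eqVneq c 0.
- by left; rewrite b0 c0 in F; apply: frame_A20 F xx xy.
- have [||||x' [y' [z' [w' [F' xx' xy']]]]] := scaled 1 c^-1 0 1.
  + exact: oner_neq0.
  + by rewrite invr_eq0.
  + by rewrite b0 mul0r.
  + by rewrite mulVf // expr1n mulr1.
  by right; left; apply: frame_A21 F' xx' xy'.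
- have [||||x' [y' [z' [w' [F' xx' xy']]]]] := scaled b 1 1 0 => //.
  + exact: oner_neq0.
  + by rewrite mul1r.
  + by rewrite c0 mul0r mulr0.
  by right; right; left; apply: frame_A22 F' xx' xy'.
- have [||||x' [y' [z' [w' [F' xx' xy']]]]] := scaled b (b ^+ 2 / c) 1 1 => //.
  + by rewrite mulf_neq0 ?expf_neq0 ?invr_eq0.
  + by rewrite mul1r.
  + by rewrite divfK // mul1r.
  by right; right; right; apply: frame_A23 F' xx' xy'.
Qed.

(** When c <> 0, the substitution x' = c x - b y makes [y, x'] vanish, at the price
    of [x', y] = - b c w, which l = b c in y' = c y + l z compensates. The z
    coefficient of [x', x'] is then c^2 and its w coefficient cancels. *)
Lemma classify_xx (x y z w : A) b c : ~ split_leib A ->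
  frame x y z w b c -> '[x, x] = z -> '[x, y] = 0 ->
  isomorphic_leib A (A24 K) \/ isomorphic_leib A (A25 K).
Proof.
move=> nsplit F xx xy; have [c0|c0] := eqVneq c 0.
  have [b0|b0] := eqVneq b 0; first by case: nsplit; apply: frame_split F xx xy b0 c0.
  left; apply: (@frame_A24 _ _ (1 *: x + 0 *: y + 0 *: z) (b^-1 *: y + 0 *: z)
                      (1 *: z + 0 *: w) ((1 * 1) *: w)).
  - apply: frame_rescale F _ _ _ _ _; rewrite ?oner_neq0 ?invr_eq0 //.
      by rewrite mul0r addr0 !mul1r mulVf.
    by rewrite c0 mulr0 mul0r.
  - rewrite (frame_bracket_xx F) xx expr0n !mulr0 !mul0r !addr0.
    by rewrite scale0r addr0 expr1n scale0r.
  - by rewrite (frame_bracket_xy F) xy scaler0 !mul0r mulr0 addr0 scale0r addr0.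
right.
pose x' := c *: x + (- b) *: y + 0 *: z; pose y' := c *: y + (b * c) *: z.
apply: (@frame_A25 _ _ x' y' (c ^+ 2 *: z + 0 *: w) ((c * c ^+ 2) *: w)).
- by apply: frame_rescale F _ _ _ _ _; rewrite ?expf_neq0 //; ring.
- rewrite (frame_bracket_xx F) xx xy scaler0 addr0; congr (_ + _ *: _); ring.
- rewrite (frame_bracket_xy F) xy scaler0 add0r -[RHS](scale0r w); congr (_ *: _); ring.
Qed.

(** Adding the multiple u of y to x removes m; the remaining multiple of w in [x, x]
    is absorbed by the z component k, as [x, z] = w. *)
Lemma normalize_xy (x y z w : A) b c m be n ga :
  frame x y z w b c -> n != 0 ->
  '[x, x] = m *: z + be *: w -> '[x, y] = n *: z + ga *: w ->
  exists x' y' z' w' b' c',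
    [/\ frame x' y' z' w' b' c', '[x', x'] = 0 & '[x', y'] = z'].
Proof.
move=> F n0 xx xy.
pose u := - m / n; pose k := - (be + u * ga + u * b + u ^+ 2 * c).
exists (1 *: x + u *: y + k *: z), (1 *: y + 0 *: z), (n *: z + (ga + u * c) *: w).
do 3 eexists; split.
- exact: (frame_change F u k 0 (ga + u * c) (oner_neq0 _) (oner_neq0 _) n0).
- rewrite (frame_bracket_xx F) xx xy !scalerDr !scalerA addrACA.
  rewrite -!scalerDl -addrA -scalerDl.
  rewrite (_ : 1 ^+ 2 * m + 1 * u * n = 0); last by rewrite /u expr1n; field.
  by rewrite scale0r add0r -[RHS](scale0r w); congr (_ *: _); rewrite /k; ring.
- rewrite (frame_bracket_xy F) xy !mul1r scale1r addr0 -addrA -scalerDl.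
  by rewrite mulr1.
Qed.

(** The product [x, y] is a multiple of w = [x, z], so subtracting a multiple of z
    from y kills it. *)
Lemma normalize_xx (x y z w : A) b c m be ga :
  frame x y z w b c -> m != 0 ->
  '[x, x] = m *: z + be *: w -> '[x, y] = ga *: w ->
  exists x' y' z' w' b' c',
    [/\ frame x' y' z' w' b' c', '[x', x'] = z' & '[x', y'] = 0].
Proof.
move=> F m0 xx xy.
exists (1 *: x + 0 *: y + 0 *: z), (1 *: y + (- ga) *: z), (m *: z + be *: w).
do 3 eexists; split.
- exact: (frame_change F 0 0 (- ga) be (oner_neq0 _) (oner_neq0 _) m0).
- rewrite (frame_bracket_xx F) xx !mulr0 !mul0r expr0n mul0r !addr0 !scale0r.
  by rewrite !addr0 expr1n scale1r.
- rewrite (frame_bracket_xy F) xy scalerA -scalerDl -[RHS](scale0r w).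
  by congr (_ *: _); ring.
Qed.

(** * Existence of a frame *)

(** The four dimensions and nilpotency enter only here: they give Leib(A) = A^2 and
    A^4 = 0, from which all the vanishing products of a frame follow. *)
Lemma exists_frame :
  \dim (fullv : {vspace A}) = 4%N -> nilpotent_leib A ->
  \dim (leib_pow A 2) = 2%N -> \dim (Leib A) = 2%N -> \dim (leib_pow A 3) = 1%N ->
  exists x y z w b c m be n ga,
    [/\ frame x y z w b c, '[x, x] = m *: z + be *: w,
        '[x, y] = n *: z + ga *: w & (m != 0) || (n != 0)].
Proof.
move=> dimA nilp dimA2 dimL dimA3.
have LeibE : Leib A = leib_pow A 2.
  by apply/eqP; rewrite eqEdim Leib_sub_square dimL dimA2.
have br_sq_l u b : u \in leib_pow A 2 -> '[u, b] = 0.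
  by rewrite -LeibE; apply: br_Leib_l.
have mem_sq a b : '[a, b] \in leib_pow A 2 by apply: mem_leib_powS; rewrite ?memvf.
have A4 : leib_pow A 4 = 0%VS.
  have A3n0 : leib_pow A 3 <> 0%VS by move=> A30; rewrite A30 dimv0 in dimA3.
  have /eqP neq := nilpotent_leib_pow_neq (isT : 0 < 3)%N nilp A3n0.
  apply/eqP; rewrite -dimv_eq0 -leqn0 -ltnS -[X in (_ < X)%N]dimA3 ltnNge.
  apply: contra neq => le.
  by rewrite eqEdim leib_powS_sub.
have br_A3_r a u : u \in leib_pow A 3 -> '[a, u] = 0.
  by move=> /(mem_leib_powS a (isT : 0 < 3)%N); rewrite A4 memv0 => /eqP.
(* Otherwise [A, A^2] = A^3 would be zero. *)
have [[x [z zA2 xz0]]|no] :=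
    pselect (exists x, exists2 z, z \in leib_pow A 2 & '[x, z] != 0); last first.
  suff : (leib_pow A 3 <= 0)%VS by rewrite subv0 -dimv_eq0 dimA3.
  apply: bracketv_sub => u v _ vA2; rewrite memv0; apply/negPn/negP => uv0.
  by apply: no; exists u, v.
set w := '[x, z] in xz0.
have wA3 : w \in leib_pow A 3 by apply: mem_leib_powS.
have wA2 : w \in leib_pow A 2 by apply: (subvP (leib_powS_sub _)) wA3.
have A3E : leib_pow A 3 = <[w]>%VS.
  by apply/esym/eqP; rewrite eqEdim -memvE wA3 dim_vline xz0 dimA3.
have znA3 : z \notin <[w]>%VS by rewrite -A3E; apply: contra xz0 => /(br_A3_r x)/eqP.
have fzw : free [:: z; w] by rewrite free_cons span_seq1 znA3 seq1_free.
have A2E : leib_pow A 2 = <<[:: z; w]>>%VS.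
  apply/esym/eqP; rewrite eqEdim dimA2 (eqP fzw) andbT.
  apply/span_subvP => v; rewrite !inE => /orP[/eqP->//|/eqP->].
  exact: wA2.
have xnA2 : x \notin <<[:: z; w]>>%VS.
  by rewrite -A2E; apply: contra xz0 => /br_sq_l; rewrite /w => ->.
have fxzw : free [:: x; z; w] by rewrite free_cons xnA2.
(* A vector completing the basis, still to be corrected so that [y, z] = 0. *)
have [y0 y0n] : exists y0, y0 \notin <<[:: x; z; w]>>%VS.
  apply/not_existsP => all_in; have /dimvS : (fullv <= <<[:: x; z; w]>>)%VS.
    by apply/subvP => v _; apply/negPn/negP/all_in.
  by rewrite dimA (eqP fxzw).
have /vlineP[k y0z] : '[y0, z] \in <[w]>%VS by rewrite -A3E mem_leib_powS.
pose y := y0 - k *: x.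
have yn : y \notin <<[:: x; z; w]>>%VS.
  by rewrite rpredBr // memvZ // memv_span // inE eqxx.
have yz : '[y, z] = 0.
  by rewrite /y brDl -scaleNr brZl y0z -/w scaleNr subrr.
have fX : free [:: x; y; z; w].
  rewrite (perm_free (Y := [:: y; x; z; w])); first by rewrite free_cons yn.
  by rewrite (perm_catCA [:: x] [:: y]).
have bX : basis_of fullv [:: x; y; z; w] by rewrite basisEfree fX subvf dimA.
have coef a b : exists m be, '[a, b] = m *: z + be *: w.
  have := mem_sq a b; rewrite A2E span_cons span_seq1.
  by move=> /memv_addP[_ /vlineP[m ->] [_ /vlineP[be ->] ->]]; exists m, be.
(* In [y, [x, a]] = [[y, x], a] + [x, [y, a]] all terms but the last vanish, and the
   last is the z coefficient of [y, a] times w. *)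
have br_y a : exists b, '[y, a] = b *: w.
  have [m [be ya]] := coef y a; have [m' [be' xa]] := coef x a.
  have := bracket_leibniz y x a.
  rewrite (br_sq_l '[y, x]) // ya xa !brDr !brZr yz !(br_A3_r _ w wA3) -/w.
  rewrite !scaler0 !addr0 add0r => /esym /eqP.
  by rewrite scaler_eq0 (negPf xz0) orbF => /eqP->; exists be; rewrite scale0r add0r.
have [m [be xx]] := coef x x; have [n [ga xy]] := coef x y.
have [b yx] := br_y x; have [c yy] := br_y y.
exists x, y, z, w, b, c, m, be, n, ga.
have F : frame x y z w b c.
  by split=> // a; [apply: br_sq_l | apply: br_sq_l | apply: br_A3_r].
split=> //; apply/negPn/negP; rewrite negb_or !negbK => /andP[/eqP m0 /eqP n0].
(* If m = n = 0 then every product lies in the line of w, although dim A^2 = 2. *)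
suff : (leib_pow A 2 <= <[w]>)%VS.
  by move/dimvS; rewrite dimA2 dim_vline; case: (_ != _).
apply: bracketv_sub => a a' _ _.
have [s [u [k1 [l ->]]]] := basis4_coord a bX.
have [s' [u' [k' [l' ->]]]] := basis4_coord a' bX.
rewrite brDr brDl !brZl !brZr (frame_wl F) (frame_wr F) !scaler0 !addr0.
rewrite (frame_bracket F) xx xy m0 n0 !scale0r !add0r.
by rewrite !rpredD ?memvZ ?memv_line.
Qed.
End Classification.

(** * The classification *)

(* For R : realType, R[i] is the field of complex numbers. *)
Theorem theorem2p6 (R : realType) (A : leibnizAlgebra R[i])
  (dimA : \dim (fullv : {vspace A}) = 4%N)
  (nsplit : ~ split_leib A)
  (nLie : non_Lie A)
  (nilp : nilpotent_leib A)
  (dimA2 : \dim (leib_pow A 2) = 2%N)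
  (dimLeib : \dim (Leib A) = 2%N)
  (dimA3 : \dim (leib_pow A 3) = 1%N) :
  isomorphic_leib A (A20 R[i]) \/ isomorphic_leib A (A21 R[i]) \/
  isomorphic_leib A (A22 R[i]) \/ isomorphic_leib A (A23 R[i]) \/
  isomorphic_leib A (A24 R[i]) \/ isomorphic_leib A (A25 R[i]).
Proof.
have [x [y [z [w [b [c [m [be [n [ga [F xx xy mn]]]]]]]]]]] :=
  exists_frame dimA nilp dimA2 dimLeib dimA3.
have [n0|n0] := eqVneq n 0; last first.
  have [x' [y' [z' [w' [b' [c' [F' xx' xy']]]]]]] := normalize_xy F n0 xx xy.
  by have := classify_xy F' xx' xy'; tauto.
rewrite n0 eqxx orbF in mn; rewrite n0 scale0r add0r in xy.
have [x' [y' [z' [w' [b' [c' [F' xx' xy']]]]]]] := normalize_xx F mn xx xy.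
by have := classify_xx nsplit F' xx' xy'; tauto.
Qed.
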